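(* Let $X$ and $X'$ be locally standard $T^m$-pseudomanifolds over graphs, with characteristic data $(Q,\lambda,0)$ and $(Q',\lambda',0)$. Then $(Q,\lambda,0)$ and $(Q',\lambda',0)$ are isomorphic (resp. weakly isomorphic) if and only if $X$ and $X'$ are $T^m$-equivariantly homeomorphic (resp. weakly $T^m$-equivariantly homeomorphic, i.e. homeomorphic via $F$ with $F(tx)=\psi(t)F(x)$ for some automorphism $\psi$ of $T^m$).
   Context: Notation: $U(1)=\{z\in\mathbb C:|z|=1\}$, $T^m=U(1)^m$, $\mathbb C^\times=\mathbb C\setminus\{0\}$, open cone $\mathring c(L)=L\times[0,1)/(L\times\{0\})$ ($\mathring c(\emptyset)$ a point). A topological stratified pseudomanifold is a Hausdorff space $Q$ with closed filtration $Q=Q_{l+n}\supsetneq\cdots\supsetneq Q_l\supsetneq\emptyset$ whose strata (components of $Q_i\setminus Q_{i-1}$) are $i$-manifolds, with $\mathring Q=Q_{l+n}\setminus Q_{l+n-1}$ dense, and each point $p$ of an $(l+i)$-stratum having a filtration-preserving neighborhood $O\times\mathring c(L_p)$, $O\subset\mathbb R^{l+i}$ contractible open, $L_p$ a compact $(n-i-1)$-dimensional topological stratified pseudomanifold (the link). Locally standard $T^m$-pseudomanifold $X$ (dimension $l+m+n$, $l\ge0$, $m\ge n\ge0$): a second-countable compact Hausdorff space with effective continuous $T^m$-action with subtorus isotropy groups, filtered by $X_{l+2i+(m-n)}=X_{l+2i+1+(m-n)}=\{x:\dim T^mx\le i+m-n\}$ ($0\le i\le n$), which is a topological stratified pseudomanifold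 with no orbits of dimension $<m-n$ and with free orbits if $l+n\ne0$, and inductively: if $l+n=0$, $X$ is a finite disjoint union of copies of $T^m$; otherwise each $x\in X_{l+2i+(m-n)}\setminus X_{l+2(i-1)+(m-n)}$ has an invariant open neighborhood weakly equivariantly homeomorphic to $O\times(\Omega\times U(1)^{m-n})\times\mathring c(L_x)$ with $O\subset\mathbb R^l$ contractible open, $\Omega\subset(\mathbb C^\times)^i$ invariant open, $L_x$ a compact $(2n-2i-1)$-dimensional locally standard $T_x$-pseudomanifold ($T_x\cong T^{n-i}$ the isotropy group), $T^m\cong U(1)^{i+m-n}\times T_x$ acting freely on the middle factor and via $L_x$ on the cone. The orbit space $Q=X/T^m$ with filtration $Q_{l+i}=X_{l+2i+(m-n)}/T^m$ is a topological stratified pseudomanifold of dimension $l+n$. When $l=0,n=1$, $Q$ is a finite graph and $X$ is called a locally standard $T^m$-pseudomanifold over a graph. Characteristic functor: $\lambda(S)$ is the common isotropy group of points over the stratum $S$. $\mathring X=X\setminus X_{l+m+n-2}$ consists of free orbits and $\mathring X\to\mathring Q$ is a principal $T^m$-bundle; its Chern class is $c^{\mathrm{free}}\in H^2(\mathring Q;\mathbb Z^m)$ (for $X$ over a graph, $c^{\mathrm{free}}=0$). The characteristic data of $X$ is $(Q,\lambda,c^{\mathrm{free}})$. A weak isomorphism $(Q,\lambda,c^{\mathrm{free}})\to(Q',\lambda',c'^{\mathrm{free}})$ is a stratified homeomorphism $f:Q\to Q'$ (a homeomorphism carrying strata onto strata and preserving the filtration) such that $(f|_{\mathring Q})^*(c'^{\mathrm{free}})=c^{\mathrm{free}}$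 and there is an automorphism $\psi$ of $T^m$ with $\psi(\lambda(S))=\lambda'(f(S))$ for all strata $S$; it is an isomorphism if $\psi=\mathrm{id}$. *)

(* Defs.v *)
From HB Require Import structures.
From mathcomp Require Import all_boot all_order all_algebra.
From mathcomp Require Import all_classical all_reals all_analysis.
From mathcomp Require Import Rstruct Rstruct_topology.
Import Order.TTheory GRing.Theory Num.Theory.
Set Implicit Arguments. Unset Strict Implicit. Unset Printing Implicit Defensive.
Local Open Scope classical_set_scope.
Local Open Scope ring_scope.

Notation RR := Rdefinitions.R.

(* The torus T^m = U(1)^m is modelled as R^m / Z^m via t |-> (e^{2 pi i t_j})_j. *)
(* An element of T^m is represented by a row vector t : 'rV[RR]_m;          *)
(* subgroups of T^m are represented by their preimages in R^m.              *)
Definition tvec (m : nat) := 'rV[RR]_m.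

Definition intvec (m : nat) (k : 'rV[int]_m) : tvec m := map_mx (fun z : int => z%:~R) k.

(* t represents the identity of T^m *)
Definition is_intvec (m : nat) (t : tvec m) : Prop := exists k : 'rV[int]_m, t = intvec k.

Definition torus_action (m : nat) (X : topologicalType) (a : tvec m -> X -> X) : Prop :=
  [/\ forall x, a 0 x = x,
      forall s t x, a (s + t) x = a s (a t x),
      forall t x, is_intvec t -> a t x = x,
      continuous (fun p : tvec m * X => a p.1 p.2) &
      forall t, (forall x, a t x = x) -> is_intvec t ].

Definition stab (m : nat) (X : Type) (a : tvec m -> X -> X) (x : X) : set (tvec m) :=
  [set t | a t x = x].

Definition same_orbit (m : nat) (X : Type) (a : tvec m -> X -> X) (x y : X) : Prop :=
  exists t, a t x = y.

Definition invariant (m : nat) (X : Type) (a : tvec m -> X -> X) (U : set X) : Prop :=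
  forall t y, U y -> U (a t y).

(* the subtorus of T^m spanned by the (R-linearly independent) integral rows
   of B, i.e. the image in T^m of the rational subspace spanned by them *)
Definition int_indep (d m : nat) (B : 'M[int]_(d, m)) : Prop :=
  forall c : 'rV[RR]_d, c *m map_mx (fun z : int => z%:~R) B = 0 -> c = 0.

Definition torus_span (d m : nat) (B : 'M[int]_(d, m)) : set (tvec m) :=
  [set t | exists (c : 'rV[RR]_d) (k : 'rV[int]_m),
           t = c *m map_mx (fun z : int => z%:~R) B + intvec k].

Definition isotropy_dim (m : nat) (X : Type) (a : tvec m -> X -> X) (x : X) (d : nat) : Prop :=
  exists B : 'M[int]_(d, m), int_indep B /\ stab a x = torus_span B.

(* dim T^m x <= n  (dim T^m x = m - dim T_x) *)
Definition orbit_dim_le (m : nat) (X : Type) (a : tvec m -> X -> X) (x : X) (n : nat) : Prop :=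
  exists d, isotropy_dim a x d /\ (m - d <= n)%N.

(* X_{m-1} = X_m = { x | dim T^m x <= m - 1 } (case l = 0, n = 1) *)
Definition sing_set (m : nat) (X : Type) (a : tvec m -> X -> X) : set X :=
  [set x | orbit_dim_le a x (m - 1)].

(* continuous automorphisms of T^m : given by matrices in GL_m(Z) *)
Definition torus_aut (m : nat) (psi : tvec m -> tvec m) : Prop :=
  exists A : 'M[int]_m, (\det A = 1 \/ \det A = -1) /\
    psi = fun t => t *m map_mx (fun z : int => z%:~R) A.

Definition CC := (RR * RR)%type.
Definition rotc (t : RR) (z : CC) : CC :=
  (cos (2 * pi * t) * z.1 - sin (2 * pi * t) * z.2,
   sin (2 * pi * t) * z.1 + cos (2 * pi * t) * z.2).
Definition cnorm2 (z : CC) : RR := z.1 ^+ 2 + z.2 ^+ 2.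

(* the 0-th coordinate of t (used when 0 < m) *)
Definition coord0 (m : nat) (t : tvec m) : RR := \sum_(i < m | val i == 0%N) t 0 i.

Definition mact (m : nat) (t : tvec m) (w : 'rV[CC]_m) : 'rV[CC]_m :=
  \row_i rotc (t 0 i) (w 0 i).

Definition good_omega (Om : set CC) : Prop :=
  [/\ open Om, ~ Om (0, 0) & forall t z, Om z -> Om (rotc t z)].

(* local model at a free point (i = 1):  Omega x U(1)^{m-1} inside C^m,
   coordinate 0 carries Omega; U(1)^m acts coordinatewise *)
Definition free_model (m : nat) (Om : set CC) : set 'rV[CC]_m :=
  [set w | forall i : 'I_m, if val i == 0%N then Om (w 0 i) else cnorm2 (w 0 i) = 1].

(* local model at a point with isotropy circle T_x (i = 0):
   U(1)^{m-1} x c(L_x), L_x = k disjoint copies of T_x = U(1) (k >= 1).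
   The first component lives in C^m, coordinate 0 being a dummy fixed to 1
   (so the U(1)^{m-1} factor uses coordinates 1..m-1); the open cone on k
   circles is realised as the wedge of k open unit disks
   { c in C^k | |c_j| < 1, at most one c_j nonzero }.
   T^m = U(1)^{m-1} x T_x, coordinate 0 of T^m being T_x, acting on the cone
   by rotating every circle. *)
Definition vert_model (m k : nat) : set ('rV[CC]_m * 'rV[CC]_k) :=
  [set p : 'rV[CC]_m * 'rV[CC]_k | [/\ forall i : 'I_m, if val i == 0%N then p.1 0 i = (1, 0)
                                 else cnorm2 (p.1 0 i) = 1,
              forall j : 'I_k, cnorm2 (p.2 0 j) < 1 &
              forall j j' : 'I_k, p.2 0 j <> (0, 0) -> p.2 0 j' <> (0, 0) -> j = j' ] ].

Definition vact (m k : nat) (t : tvec m) (p : 'rV[CC]_m * 'rV[CC]_k)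
  : 'rV[CC]_m * 'rV[CC]_k :=
  (\row_i (if val i == 0%N then p.1 0 i else rotc (t 0 i) (p.1 0 i)),
   \row_j rotc (coord0 t) (p.2 0 j)).

Definition weq_homeo_onto (m : nat) (X Y : topologicalType)
  (a : tvec m -> X -> X) (b : tvec m -> Y -> Y) (U : set X) (M : set Y) : Prop :=
  exists (psi : tvec m -> tvec m) (F : X -> Y) (G : Y -> X), torus_aut psi /\
   F @` U `<=` M /\ G @` M `<=` U /\
   (forall y, U y -> G (F y) = y) /\ (forall z, M z -> F (G z) = z) /\
   {within U, continuous F} /\ {within M, continuous G} /\
   (forall t y, U y -> F (a t y) = b (psi t) (F y)).

Definition lsp_over_graph (m : nat) (X : topologicalType) (a : tvec m -> X -> X) : Prop :=
  (0 < m)%N /\ hausdorff_space X /\ @second_countable X /\ compact [set: X] /\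
      torus_action a /\
      (forall x, exists d, isotropy_dim a x d) /\
      (forall x d, isotropy_dim a x d -> (m - 1 <= m - d)%N) /\
      (* filtration X = X_{m+1} ⊋ X_{m-1} ⊋ ∅, with dense top stratum;
         there are free orbits *)
      [/\ exists x, sing_set a x,
          exists x, ~ sing_set a x &
          closure (~` sing_set a) = [set: X] ] /\
      (forall x, ~ sing_set a x ->
         exists (U : set X) (Om : set CC),
           [/\ open U, U x, invariant a U, good_omega Om &
               weq_homeo_onto a (@mact m) U (@free_model m Om)]) /\
      (forall x, sing_set a x ->
         exists (U : set X) (k : nat),
           [/\ (0 < k)%N, open U, U x, invariant a U &
               weq_homeo_onto a (@vact m k) U (@vert_model m k)]).

(* (weak) isomorphism of characteristic data (Q, lambda, 0) -> (Q', lambda', 0)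
   via the automorphism psi of T^m.  A map f : Q -> Q' of orbit spaces is
   given by a lift g : X -> X' (f [x] = [g x]); f^{-1} by a lift h.
   Continuity of f for the quotient topologies: preimages under g of
   invariant open sets are open.  Stratified = preserves the filtration
   (Q_0 = X_{m-1}/T^m).  lambda(S) = isotropy group of the points over S. *)
Definition chardata_iso_via (m : nat) (X X' : topologicalType)
  (a : tvec m -> X -> X) (a' : tvec m -> X' -> X') (psi : tvec m -> tvec m) : Prop :=
  exists (g : X -> X') (h : X' -> X),
  (forall x y, same_orbit a x y -> same_orbit a' (g x) (g y)) /\
  (forall x y, same_orbit a' x y -> same_orbit a (h x) (h y)) /\
  (forall x, same_orbit a (h (g x)) x) /\
  (forall x, same_orbit a' (g (h x)) x) /\
  (forall W, open W -> invariant a' W -> open (g @^-1` W)) /\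
  (forall W, open W -> invariant a W -> open (h @^-1` W)) /\
  (forall x, sing_set a x <-> sing_set a' (g x)) /\
  (forall x, psi @` stab a x = stab a' (g x)).

Definition eq_homeo_via (m : nat) (X X' : topologicalType)
  (a : tvec m -> X -> X) (a' : tvec m -> X' -> X') (psi : tvec m -> tvec m) : Prop :=
  exists (F : X -> X') (G : X' -> X),
  [/\ continuous F, continuous G, cancel F G, cancel G F &
      forall t x, F (a t x) = a' (psi t) (F x) ].

(* Main.v *)
Require Import Defs.
From HB Require Import structures.
From mathcomp Require Import all_boot all_order all_algebra.
From mathcomp Require Import all_classical all_reals all_analysis.
From mathcomp Require Import Rstruct Rstruct_topology.
From mathcomp Require Import ring lra.

(** The converse being formal, the point is that [X] contains a compact set [K]
    meeting every orbit exactly once. Given such sections [K] and [K'], an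
    isomorphism of characteristic data induces a continuous map [Phi : K -> K'],
    and [a t k |-> a' (psi t) (Phi k)] is well defined and bijective because the
    isotropy groups correspond; it is continuous because [X] is a quotient of
    the compact space [[0, 1]^m * K].

    Sections exist locally, in the charts, over closed pieces of the orbit graph
    bounded by finitely many points. To glue a second piece onto a first one,
    remove from the second the interior of the first: they then meet in
    finitely many orbits, over which the second section can be moved onto the
    first by acting with a continuous function valued in [R^m], as prescribing
    such a function at finitely many points is no obstruction. *)

Set Implicit Arguments. Unset Strict Implicit. Unset Printing Implicit Defensive.
Import Order.TTheory GRing.Theory Num.Theory.
Import numFieldNormedType.Exports.
Local Open Scope classical_set_scope.
Local Open Scope ring_scope.

(** * Separation and continuity preliminaries *)

Lemma bump_function (X : topologicalType) (x : X) (A : set X) :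
  hausdorff_space X -> compact [set: X] -> finite_set A -> ~ A x ->
  exists f : X -> RR, [/\ continuous f, f x = 1 & forall y, A y -> f y = 0].
Proof.
move=> hX cX fA nAx.
have cl := accessible_finite_set_closed.1 (hausdorff_accessible hX).
have AxI : A `&` [set x] = set0.
  by apply/seteqP; split=> // y [Ay /= yx]; apply: nAx; rewrite -yx.
have /(uniform_separatorP (R := RR))[f [cf _ f0 f1]] :=
  (@normal_separatorP RR X).1 (compact_normal hX cX) _ _
    (cl _ fA) (cl _ (finite_set1 x)) AxI.
exists f; split=> //; first by apply: f1; exists x.
by move=> y Ay; apply: f0; exists y.
Qed.

Lemma rV_continuous (T U : topologicalType) (n : nat) (f : T -> 'rV[U]_n) :
  (forall i, continuous (fun x => f x 0 i)) -> continuous f.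
Proof.
move=> cf x A [P Pn PA].
have : \forall z \near x, forall j, P 0 j (f z 0 j).
  by apply: filter_forall => j; apply: cf; exact: Pn.
by apply: filterS => z Pz; apply: PA => i j; rewrite ord1.
Qed.

(** * Partial sections of a torus action and their gluing *)

Section TorusActions.
Variables (m : nat) (X : topologicalType) (a : tvec m -> X -> X).
Hypothesis act : torus_action a.
Implicit Types (x y : X) (K L : set X).

Lemma actD s t x : a (s + t) x = a s (a t x).
Proof. by case: act. Qed.

Lemma act0 x : a 0 x = x.
Proof. by case: act. Qed.

Lemma actNK t x : a (- t) (a t x) = x.
Proof. by rewrite -actD addNr act0. Qed.

Lemma same_orbit_refl x : same_orbit a x x.
Proof. by exists 0; rewrite act0. Qed.

Lemma same_orbit_sym x y : same_orbit a x y -> same_orbit a y x.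
Proof. by move=> [t <-]; exists (- t); rewrite actNK. Qed.

Lemma same_orbit_trans y x z :
  same_orbit a x y -> same_orbit a y z -> same_orbit a x z.
Proof. by move=> [t <-] [s <-]; exists (s + t); rewrite actD. Qed.

Lemma stab_same_orbit x y : same_orbit a x y -> stab a x = stab a y.
Proof.
move=> [s <-]; apply/seteqP; split=> t; rewrite /stab /= => tx.
  by rewrite -actD addrC actD tx.
by rewrite -[LHS](actNK s) -(actD s t) (addrC s) actD tx actNK.
Qed.

(** The orbit space is never formed: its subsets are handled as invariant subsets of [X]. This one
    is the preimage of the image of [K]. *)
Definition saturation K : set X := [set x | exists2 k, K k & same_orbit a k x].

Definition partial_section K :=
  compact K /\ forall x y, K x -> K y -> same_orbit a x y -> x = y.

Lemma saturation_same_orbit K x y :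
  same_orbit a x y -> saturation K x -> saturation K y.
Proof. by move=> xy [k Kk kx]; exists k => //; exact: same_orbit_trans xy. Qed.

Lemma sub_saturation K : K `<=` saturation K.
Proof. by move=> k Kk; exists k => //; exact: same_orbit_refl. Qed.

Lemma act_continuous (T : topologicalType) (u : T -> tvec m) (f : T -> X) :
  continuous u -> continuous f -> continuous (fun z => a (u z) (f z)).
Proof.
move=> cu cf z; case: act => _ _ _ ca _.
apply: (@continuous2_cvg _ _ _ _ (nbhs z) _ u f a (u z) (f z)); last 2 first.
- exact: cu.
- exact: cf.
exact: (ca (u z, f z)).
Qed.

(** Write [p] as [a t k] with [k] in [K], and move each [x] by [f x *: t], where the bump function
    [f] is 1 at [k] and 0 on [A]. Points stay in their orbits, so neither uniqueness nor the
    saturation is affected. Scaling [t] makes sense because the action is written on [R^m] and not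
    on the quotient torus. *)
Lemma partial_section_move K p A :
  hausdorff_space X -> compact [set: X] ->
  partial_section K -> saturation K p -> finite_set A -> A `<=` K ->
  (forall y, A y -> ~ same_orbit a y p) ->
  exists K', [/\ partial_section K', saturation K' = saturation K, K' p &
                 A `<=` K'].
Proof.
move=> hX cX [cK uK] [k Kk [t ktp]] fA AK nAp.
have nAk : ~ A k by move=> /nAp; apply; exists t.
have [f [cf fk fA0]] := bump_function hX cX fA nAk.
pose w x := a (f x *: t) x.
have cw : continuous w.
  apply: act_continuous; last by move=> ?; exact: cvg_id.
  by move=> x; apply: cvgZr_tmp; exact: cf.
have wo x : same_orbit a x (w x) by exists (f x *: t).
exists (w @` K); split.
- split; first by apply: continuous_compact => //; exact: continuous_subspaceT.
  move=> _ _ [x Kx <-] [y Ky <-] xy; congr (w _); apply: uK => //.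
  apply: (same_orbit_trans (wo x)); apply: (same_orbit_trans xy).
  exact: same_orbit_sym.
- apply/seteqP; split=> y.
    by move=> [_ [x Kx <-] xy]; exists x => //; exact: same_orbit_trans xy.
  move=> [x Kx xy]; exists (w x); first by exists x.
  exact: same_orbit_trans (same_orbit_sym (wo x)) xy.
- by exists k => //; rewrite /w fk scale1r.
- by move=> y Ay; exists y; [exact: AK|rewrite /w fA0// scale0r act0].
Qed.

(** The points of [P] are reached one at a time, each move fixing those already reached. As [P]
    meets an orbit at most once, the new point lies in none of their orbits. *)
Lemma partial_section_through K P :
  hausdorff_space X -> compact [set: X] ->
  partial_section K -> finite_set P -> P `<=` saturation K ->
  (forall x y, P x -> P y -> same_orbit a x y -> x = y) ->
  exists K', [/\ partial_section K', saturation K' = saturation K & P `<=` K'].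
Proof.
move=> hX cX sK /finite_seqP[s ->{P}].
elim: s => [|p s IH] PK uP; first by exists K; split.
have [||K1 [sK1 K1K sub1]] := IH.
- by move=> y ys; apply: PK; rewrite /= inE ys orbT.
- by move=> x y xs ys; apply: uP; rewrite /= inE ?xs ?ys orbT.
(* The enumeration of [P] may repeat a point, in which case there is nothing to move. *)
have [ps|pNs] := boolP (p \in s).
  exists K1; split=> // y; rewrite /= inE => /orP[/eqP ->|]; exact: sub1.
have [||||K2 [sK2 K2K K2p sub2]] := @partial_section_move K1 p [set` s] hX cX sK1.
- by rewrite K1K; apply: PK; rewrite /= inE eqxx.
- exact: finite_seq.
- by [].
- move=> y ys yp; move: pNs; rewrite -(uP y p) ?ys//= ?inE ?eqxx//.
  by rewrite ys orbT.
exists K2; split=> //; first by rewrite K2K.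
by move=> y; rewrite /= inE => /orP[/eqP ->//|]; exact: sub2.
Qed.

(* The boundary of [saturation K] lies in the finitely many orbits of
   [K `\` V]; [V] stands in for the interior. *)
Definition slice K (V : set X) :=
  [/\ partial_section K, open V, Defs.invariant a V, V `<=` saturation K &
      finite_set (K `\` V)].

Lemma invariant_same_orbit (V : set X) x y :
  Defs.invariant a V -> same_orbit a x y -> V x -> V y.
Proof. by move=> iV [t <-]; exact: iV. Qed.

(** Cut [L] down to [L0], its part outside [V]. The saturation of [L0] avoids [V], so [K] can meet
    it only in the finite set [K]\[V]. Once [L0] is moved through these common points, its union
    with [K] meets each orbit at most once. *)
Lemma slice_glue K V L W : hausdorff_space X -> compact [set: X] ->
  slice K V -> slice L W -> exists M, slice M (V `|` W).
Proof.
move=> hX cX [[cK uK] oV iV VK fK] [[cL uL] oW iW WL fL].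
pose L0 := L `&` ~` V.
have sL0 : partial_section L0.
  split; first by apply: compact_closedI => //; exact: open_closedC.
  by move=> x y [Lx _] [Ly _]; exact: uL.
have satL0 x : saturation L x -> ~ V x -> saturation L0 x.
  move=> [l Ll lx] nVx; exists l => //; split=> // Vl.
  exact/nVx/(invariant_same_orbit iV lx).
have L0NV x : saturation L0 x -> ~ V x.
  move=> [l [_ nVl] lx] Vx.
  exact/nVl/(invariant_same_orbit iV _ Vx)/same_orbit_sym.
have [||||L1 [sL1 L1L0 sub1]] :=
  @partial_section_through L0 ((K `\` V) `&` saturation L0) hX cX.
- by [].
- by apply: sub_finite_set fK => x [].
- by move=> x [].
- by move=> x y [[Kx _] _] [[Ky _] _]; exact: uK.
have KL1 x y : K x -> L1 y -> same_orbit a x y -> x = y.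
  move=> Kx L1y xy.
  have L0x : saturation L0 x.
    by rewrite -L1L0; exists y => //; exact: same_orbit_sym.
  by apply: sL1.2 => //; apply: sub1; split=> //; split=> //; exact: L0NV.
exists (K `|` L1); split.
- split; first by apply: compactU => //; case: sL1.
  move=> x y [Kx|Lx] [Ky|Ly] xy.
  + exact: uK.
  + exact: KL1.
  + by apply/esym/KL1 => //; exact: same_orbit_sym.
  + exact: sL1.2.
- exact: openU.
- by move=> t y [Vy|Wy]; [left; exact: iV|right; exact: iW].
- have sK x : V x -> saturation (K `|` L1) x.
    by move=> /VK[k Kk kx]; exists k => //; left.
  move=> x [/sK//|Wx]; have [/sK//|nVx] := pselect (V x).
  have := satL0 _ (WL _ Wx) nVx; rewrite -L1L0 => -[l Ll lx].
  by exists l => //; right.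
(* Moving [L0] to [L1] keeps finiteness: [s] sends a point of [L0] to the point of [L1] in its
   orbit, and a point of [L1] outside [V] and [W] comes from one of [L]\[W]. *)
- pose s z := xget z [set y | L1 y /\ same_orbit a z y].
  apply: (@sub_finite_set _ _ ((K `\` V) `|` (s @` (L `\` W)))); last first.
    by rewrite finite_setU; split=> //; exact: finite_image.
  move=> y [[Ky|Ly] /not_orP[nVy nWy]]; first by left.
  right; have [z [Lz nVz] zy] : saturation L0 y.
    by rewrite -L1L0; exact: sub_saturation.
  have [L1s zs] : L1 (s z) /\ same_orbit a z (s z).
    by apply: (@xgetPex _ z [set y | L1 y /\ same_orbit a z y]); exists y.
  exists z; last first.
    by apply: sL1.2 => //; apply: same_orbit_trans zy; exact: same_orbit_sym.
  by split=> // Wz; apply/nWy/(invariant_same_orbit iW zy).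
Qed.

(** Compactness enters through cluster points. By gluing, the complements of the open sets that
    carry a slice form a filter base. If none of these open sets is all of [X], the filter is proper
    and clusters at some [p], which a slice around [p] contradicts. *)
Lemma global_section : hausdorff_space X -> compact [set: X] ->
  (forall x, exists K V, slice K V /\ V x) ->
  exists K, partial_section K /\ saturation K = [set: X].
Proof.
move=> hX cX loc.
have [[K [sK _ _ KT _]]|noT] := pselect (exists K, slice K setT).
  by exists K; split=> //; apply/seteqP; split.
pose D := [set V : set X | exists K, slice K V].
have D0 : D set0.
  exists set0; split => //; first by split=> //; exact: compact0.
  - exact: open0.
  - by rewrite set0D.
have FF : Filter (filter_from D setC).
  apply: filter_from_filter; first by exists set0.
  move=> V W [K sK] [L sL]; have [M sM] := slice_glue hX cX sK sL.
  by exists (V `|` W); [exists M|rewrite setCU].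
have PF : ProperFilter (filter_from D setC).
  apply: filter_from_proper => V [K sK]; apply/set0P/eqP => V0.
  by apply: noT; exists K; rewrite -(setCK V) V0 setC0 in sK *.
have [|p [_ clp]] := cX _ PF; first exact: filterT.
have [K [V [sK Vp]]] := loc p.
have [||y [nVy Vy]] := clp (~` V) V; [by exists V => //; exists K| |by []].
by apply: open_nbhs_nbhs; split=> //; case: sK.
Qed.

End TorusActions.

(** * Automorphisms of the torus and transport of slices through charts *)

Lemma unimodular_unitmx (m : nat) (A : 'M[int]_m) :
  \det A = 1 \/ \det A = -1 -> A \in unitmx.
Proof. by rewrite unitmxE => -[] ->; rewrite ?unitrN1 ?unitr1. Qed.

Lemma torus_aut_inverse (m : nat) (psi : tvec m -> tvec m) : torus_aut psi ->
  exists2 phi, torus_aut phi & cancel psi phi /\ cancel phi psi.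
Proof.
move=> [A [detA ->]].
have uA := unimodular_unitmx detA.
pose f := (intmul 1 : {rmorphism int -> RR}).
exists (fun t => t *m map_mx f (invmx A)).
  exists (invmx A); split=> //; rewrite det_inv.
  by case: detA => ->; [left|right]; rewrite ?invr1 ?invrN1.
split=> t; rewrite -mulmxA -(map_mxM f) ?mulmxV ?mulVmx//.
  by rewrite (map_mx1 f) mulmx1.
by rewrite (map_mx1 f) mulmx1.
Qed.

(** Reduces the search for a slice to the model: a compact transversal [P] and an invariant open set
    [O] are enough, provided that [P] meets every orbit of the model inside [O] and leaves [O] at
    finitely many points only. The inverse automorphism [phi] converts the time needed in the model
    into a time for [a]. *)
Lemma slice_of_chart (m : nat) (X Y : topologicalType)
    (a : tvec m -> X -> X) (b : tvec m -> Y -> Y) (U : set X) (M P O : set Y) :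
  torus_action a -> open U -> Defs.invariant a U ->
  compact P -> P `<=` M ->
  (forall p q t, P p -> P q -> b t p = q -> p = q) ->
  open O -> (forall t p, O p -> O (b t p)) ->
  (forall q, M q -> O q -> exists p t, P p /\ b t p = q) ->
  finite_set (P `\` O) ->
  forall (psi : tvec m -> tvec m) (F : X -> Y) (G : Y -> X), torus_aut psi ->
   F @` U `<=` M -> G @` M `<=` U ->
   (forall y, U y -> G (F y) = y) -> (forall z, M z -> F (G z) = z) ->
   {within U, continuous F} -> {within M, continuous G} ->
   (forall t y, U y -> F (a t y) = b (psi t) (F y)) ->
  slice a (G @` P) (U `&` F @^-1` O).
Proof.
move=> act oU iU cP PM uP oO iO OP fP psi F G apsi FUM GMU GF FG cF cG Fact.
have GU p : P p -> U (G p) by move=> Pp; apply: GMU; exists p => //; exact: PM.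
have [phi _ [_ phiK]] := torus_aut_inverse apsi.
split.
- split.
    by apply: continuous_compact => //; exact: continuous_subspaceW cG.
  move=> _ _ [p Pp <-] [q Pq <-] [t tpq]; congr (G _).
  apply: (uP _ _ (psi t)) => //.
  have /(congr1 F) := tpq.
  by rewrite Fact ?FG//; [exact: PM|exact: PM|exact: GU].
- by rewrite continuous_open_subspace // in cF; apply: (continuous_inP F oU).1.
- by move=> t y [Uy Oy]; split; [exact: iU|rewrite /= Fact//; exact: iO].
- move=> y [Uy /= Oy]; have [|p [t [Pp ptq]]] := OP _ _ Oy.
    by apply: FUM; exists y.
  exists (G p); first by exists p.
  exists (phi t); rewrite -[RHS]GF// -ptq -(GF (a _ _)); last exact/iU/GU.
  by rewrite Fact ?FG ?phiK//; [exact: PM|exact: GU].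
- apply: (@sub_finite_set _ _ (G @` (P `\` O))); last exact: finite_image.
  move=> _ [[p Pp <-] nV]; exists p => //; split=> // Op; apply: nV.
  by split; [exact: GU|rewrite /= FG//; exact: PM].
Qed.

(** * Polar coordinates in the plane *)

Lemma cnorm2_rotc t z : cnorm2 (rotc t z) = cnorm2 z.
Proof.
rewrite /cnorm2 /rotc /=; set c := cos _; set s := sin _.
have -> : (c * z.1 - s * z.2) ^+ 2 + (s * z.1 + c * z.2) ^+ 2 =
  (c ^+ 2 + s ^+ 2) * (z.1 ^+ 2 + z.2 ^+ 2) by ring.
by rewrite cos2Dsin2 mul1r.
Qed.

Lemma cnorm2_ge0 z : 0 <= cnorm2 z.
Proof. by rewrite addr_ge0 ?sqr_ge0. Qed.

Lemma cnorm2_eq0 z : (cnorm2 z == 0) = (z == (0, 0)).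
Proof.
by case: z => x y; rewrite /cnorm2 /= paddr_eq0 ?sqr_ge0// !sqrf_eq0 xpair_eqE.
Qed.

Lemma cnorm2_real s : cnorm2 (s, 0) = s ^+ 2.
Proof. by rewrite /cnorm2/= expr0n addr0. Qed.

(** The angle is [acos x] up to sign, since its sine is the absolute value of [y]; the sign of [y]
    decides. *)
Lemma unit_circle_angle (x y : RR) :
  x ^+ 2 + y ^+ 2 = 1 -> exists u, cos u = x /\ sin u = y.
Proof.
move=> xy1.
have x1 : -1 <= x <= 1.
  by have y2 := sqr_ge0 y; apply/andP; split; nra.
have sy : sin (acos x) = `|y|.
  by rewrite sin_acos// -sqrtr_sqr; congr Num.sqrt; lra.
have cx : cos (acos x) = x by rewrite acosK// in_itv.
have [y0|y0] := leP 0 y.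
  by exists (acos x); rewrite sy cx ger0_norm.
by exists (- acos x); rewrite cosN sinN sy cx ltr0_norm ?opprK.
Qed.

Lemma polar z : exists t, rotc t (Num.sqrt (cnorm2 z), 0) = z.
Proof.
have [/eqP z0|z0] := eqVneq (cnorm2 z) 0.
  exists 0; rewrite (eqP z0) sqrtr0 /rotc /= !mulr0 subr0 addr0.
  by rewrite cnorm2_eq0 in z0; rewrite (eqP z0).
set r := Num.sqrt _.
have r2 : r ^+ 2 = cnorm2 z by rewrite sqr_sqrtr ?cnorm2_ge0.
have r0 : r != 0 by apply: contraNneq z0 => r0; rewrite -r2 r0 expr0n.
have [|u [cu su]] := @unit_circle_angle (z.1 / r) (z.2 / r).
  by rewrite !exprMn exprVn -mulrDl -/(cnorm2 z) -r2 divff// expf_neq0.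
have pi0 : pi != 0 :> RR by rewrite gt_eqF// pi_gt0.
(* [rotc] counts angles in full turns. *)
exists (u / (2 * pi)); rewrite /rotc /=.
have -> : 2 * pi * (u / (2 * pi)) = u.
  by rewrite mulrC divfK// mulf_neq0 ?pnatr_eq0.
rewrite cu su !mulr0 subr0 addr0 !divfK//.
by case: z {r2 z0 cu su} @r r0.
Qed.

(** * Slices in the two local models *)

Lemma rV_coord_continuous (U : topologicalType) (n : nat) (i : 'I_n) :
  continuous (fun v : 'rV[U]_n => v 0 i).
Proof.
move=> v A nA; exists (fun _ j => if j == i then A else setT).
  by move=> k j; rewrite ord1; case: eqP => [->//|_]; exact: filterT.
by move=> w /(_ 0 i); rewrite eqxx.
Qed.

Lemma sqr_norm_continuous (R : realType) :
  continuous (fun z : R * R => z.1 ^+ 2 + z.2 ^+ 2).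
Proof.
move=> z; apply: cvgD.
  by apply: (@continuous_comp _ _ _ fst (fun r : R => r ^+ 2));
    [exact: cvg_fst|exact: exprn_continuous].
by apply: (@continuous_comp _ _ _ snd (fun r : R => r ^+ 2));
  [exact: cvg_snd|exact: exprn_continuous].
Qed.

Lemma cnorm2_continuous : continuous cnorm2.
Proof. exact: (@sqr_norm_continuous RR). Qed.

Lemma open_segment (R : realType) (x y : R) : open [set z | x < z < y].
Proof.
have -> : [set z | x < z < y] = [set z | z > x] `&` [set z | z < y].
  by apply/seteqP; split=> z /=; [move=> /andP|move/andP].
by apply: openI; [exact: open_gt|exact: open_lt].
Qed.

Lemma pair_continuous (T U V : topologicalType) (f : T -> U) (g : T -> V) :
  continuous f -> continuous g -> continuous (fun x => (f x, g x)).
Proof.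
move=> cf cg x A [[B C] [nB nC] BC].
have nf : nbhs x (f @^-1` B) by exact: cf.
have ng : nbhs x (g @^-1` C) by exact: cg.
apply: filterS (filterI nf ng) => z [Bz Cz].
exact: (BC (f z, g z)).
Qed.

Lemma real_pair_continuous : continuous (fun s : RR => (s, 0) : CC).
Proof. by apply: pair_continuous => s; [exact: cvg_id|exact: cvg_cst]. Qed.

Lemma rotcNK t z : rotc (- t) (rotc t z) = z.
Proof.
case: z => x y; rewrite /rotc /= mulrN cosN sinN.
have := cos2Dsin2 (2 * pi * t); set c := cos _; set s := sin _ => cs.
congr (_, _).
  transitivity ((c ^+ 2 + s ^+ 2) * x); first by ring.
  by rewrite cs mul1r.
transitivity ((c ^+ 2 + s ^+ 2) * y); first by ring.
by rewrite cs mul1r.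
Qed.

(** Orbits of the free model are classified by the modulus of coordinate 0. The transversal is a
    segment of positive reals in [Om], all other coordinates being 1, and the open set is the
    annulus it sweeps out, so only its two end points are left over. *)
Lemma free_slice (m : nat) (X : topologicalType) (a : tvec m -> X -> X)
    (U : set X) (Om : set CC) (x : X) :
  (0 < m)%N -> torus_action a -> open U -> U x -> Defs.invariant a U ->
  good_omega Om -> weq_homeo_onto a (@mact m) U (free_model Om) ->
  exists K V, slice a K V /\ V x.
Proof.
move=> m0 act oU Ux iU [oOm nOm iOm].
move=> [psi [F [G [apsi [FU [GM [GF [FG [cF [cG Fact]]]]]]]]]].
pose i0 : 'I_m := Ordinal m0.
have FxM : free_model Om (F x) by apply: FU; exists x.
have Omx : Om (F x 0 i0) by have := FxM i0.
set r := Num.sqrt (cnorm2 (F x 0 i0)).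
have Omr : Om (r, 0).
  have [t rt] := polar (F x 0 i0).
  by rewrite -(rotcNK t (r, 0)) rt; exact: iOm.
have r0 : 0 < r.
  rewrite lt_neqAle sqrtr_ge0 andbT eq_sym; apply: contra_notN nOm => /eqP r0.
  by rewrite -{1}r0.
have r2 : r ^+ 2 = cnorm2 (F x 0 i0) by rewrite sqr_sqrtr ?cnorm2_ge0.
have [e e0 [er eOm]] : exists2 e, 0 < e & e < r /\
    forall s, r - e <= s <= r + e -> Om (s, 0).
  have : nbhs r [set s : RR | Om (s, 0)].
    by apply: real_pair_continuous; apply: open_nbhs_nbhs; split.
  move=> /nbhs_ballP[d /= d0 dOm].
  (* Halving keeps the closed segment inside the open [d]-ball, and the bound by [r] keeps it away
     from 0. *)
  exists (Num.min d r / 2); first by rewrite divr_gt0// lt_min d0.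
  split.
    by rewrite ltr_pdivrMr// (@le_lt_trans _ _ r) ?ge_min ?lexx ?orbT//; lra.
  move=> s rs; apply: dOm; rewrite /ball/= ltr_distlC.
  have md : Num.min d r <= d by rewrite ge_min lexx.
  by apply/andP; split; lra.
pose c (s : RR) : 'rV[CC]_m := \row_i (if val i == 0%N then (s, 0) else (1, 0)).
have cc : continuous c.
  apply: rV_continuous => i.
  have -> : (fun s => c s 0 i) =
      fun s => if val i == 0%N then (s, 0) else (1, 0).
    by apply/funext => s; rewrite mxE.
  case: (val i == 0%N); first exact: real_pair_continuous.
  by move=> s; exact: cvg_cst.
(* Comparing squares is harmless because [r - e] is positive. *)
pose O := [set w : 'rV[CC]_m | (r - e) ^+ 2 < cnorm2 (w 0 i0) < (r + e) ^+ 2].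
pose P := c @` [set` `[r - e, r + e]].
have oO : open O.
  have cN : continuous (fun w : 'rV[CC]_m => cnorm2 (w 0 i0)).
    move=> w; apply: (@continuous_comp _ _ _ (fun w : 'rV[CC]_m => w 0 i0)).
      exact: rV_coord_continuous.
    exact: cnorm2_continuous.
  exact: (continuousP _).1 cN _ (@open_segment RR _ _).
exists (G @` P), (U `&` F @^-1` O); split; last first.
  by split=> //; rewrite /O /= -r2; apply/andP; split; nra.
apply: (@slice_of_chart _ _ _ a (@mact m) U (free_model Om)) => //.
- apply: continuous_compact; first exact: continuous_subspaceT.
  exact: segment_compact.
- move=> _ [s /= sr <-] i; rewrite /c mxE; case: (val i == 0%N).
    by apply: eOm; rewrite in_itv in sr.
  by rewrite cnorm2_real expr1n.
- move=> _ _ t [s /= sr <-] [s' /= sr' <-] /rowP /(_ i0) /(congr1 cnorm2).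
  rewrite !mxE /= cnorm2_rotc !cnorm2_real => ss'; congr c.
  move: sr sr'; rewrite !in_itv /= => sr sr'; apply/eqP.
  by rewrite -(@eqrXn2 _ 2) ?ss'//; lra.
- by move=> t p; rewrite /O /= mxE cnorm2_rotc.
- move=> q Mq Oq; exists (c (Num.sqrt (cnorm2 (q 0 i0)))).
  exists (\row_i sval (cid (polar (q 0 i)))); split.
    eexists; last reflexivity.
    move: Oq; rewrite /O /= in_itv /= => /andP[q1 q2]; apply/andP; split.
      rewrite -(@ler_pXn2r _ 2) ?nnegrE ?sqrtr_ge0 ?sqr_sqrtr ?cnorm2_ge0// ?ltW//.
      lra.
    rewrite -(@ler_pXn2r _ 2) ?nnegrE ?sqrtr_ge0 ?sqr_sqrtr ?cnorm2_ge0// ?ltW//.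
    lra.
  apply/rowP => i; rewrite !mxE; case: cid => t /= <-.
  congr rotc; have := Mq i; case: ifPn => [/eqP i00 _|_ ->].
    by congr (Num.sqrt (cnorm2 (q 0 _)), _); exact: val_inj.
  by rewrite sqrtr1.
- apply: (@sub_finite_set _ _ ([set c (r - e)] `|` [set c (r + e)])).
    move=> _ [[s /= sr <-] nO]; move: sr; rewrite in_itv /= => /andP[s1 s2].
    have [->|ns1] := eqVneq s (r - e); first by left.
    have [->|ns2] := eqVneq s (r + e); first by right.
    have {}s1 : r - e < s by rewrite lt_neqAle eq_sym ns1.
    have {}s2 : s < r + e by rewrite lt_neqAle ns2.
    exfalso; apply: nO; rewrite /O /= mxE /= cnorm2_real.
    by apply/andP; split; nra.
  by rewrite finite_setU; split; exact: finite_set1.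
- exact: apsi.
- exact: Fact.
Qed.

Lemma continuous_sum (R : realType) (T : topologicalType) (n : nat)
    (f : 'I_n -> T -> R) :
  (forall i, continuous (f i)) -> continuous (fun x => \sum_i f i x).
Proof.
elim: n f => [|n IH] f cf.
  have -> : (fun x => \sum_i f i x) = fun=> 0.
    by apply/funext => x; rewrite big_ord0.
  by move=> x; exact: cvg_cst.
have -> : (fun x => \sum_i f i x) =
    (fun x => f ord0 x + \sum_i f (lift ord0 i) x).
  by apply/funext => x; rewrite big_ord_recl.
by move=> x; apply: cvgD; [exact: cf|exact: IH].
Qed.

(** The transversal is a star: one radius of length [r] in each of the [k] disks, joined at the cone
    point. The invariant [N] is the squared distance to the cone point along the wedge, and the open
    set [N < r ^+ 2] misses only the [k] outer ends of the star. *)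
Lemma vert_slice (m k : nat) (X : topologicalType) (a : tvec m -> X -> X)
    (U : set X) (x : X) :
  (0 < m)%N -> (0 < k)%N -> torus_action a ->
  open U -> U x -> Defs.invariant a U ->
  weq_homeo_onto a (@vact m k) U (@vert_model m k) ->
  exists K V, slice a K V /\ V x.
Proof.
move=> m0 k0 act oU Ux iU.
move=> [psi [F [G [apsi [FU [GM [GF [FG [cF [cG Fact]]]]]]]]]].
pose Y := ('rV[CC]_m * 'rV[CC]_k)%type.
pose N (p : Y) : RR := \sum_j cnorm2 (p.2 0 j).
have wedge (p : Y) : vert_model p ->
    exists2 j, (forall i, i != j -> p.2 0 i = (0, 0)) & N p = cnorm2 (p.2 0 j).
  move=> [_ _ uniq_nz].
  have [j pj] : exists j, forall i, i != j -> p.2 0 i = (0, 0).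
    have [[j pj]|nz] := pselect (exists j, p.2 0 j <> (0, 0)).
      exists j => i /eqP ij; apply: contrapT => pi; exact/ij/uniq_nz.
    (* At the cone point every coordinate vanishes and any index will do. *)
    exists (Ordinal k0) => i _; apply: contrapT => pi; apply: nz.
    by exists i.
  exists j => //; rewrite /N (bigD1 j)//= big1 ?addr0// => i /pj ->.
  by rewrite cnorm2_real expr0n.
have Fx : vert_model (F x) by apply: FU; exists x.
have Nx1 : N (F x) < 1.
  by have [j _ ->] := wedge _ Fx; case: Fx.
have Nx0 : 0 <= N (F x) by apply: sumr_ge0 => j _; exact: cnorm2_ge0.
(* [r ^+ 2] is the midpoint of [N (F x)] and 1, so that [O] contains [F x] while the closed radii
   stay in the open disks. *)
pose r := Num.sqrt ((1 + N (F x)) / 2).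
have r2 : r ^+ 2 = (1 + N (F x)) / 2 by rewrite sqr_sqrtr//; lra.
have r0 : 0 <= r by exact: sqrtr_ge0.
have r1 : r < 1 by nra.
pose d (j : 'I_k) (s : RR) : Y :=
  (\row__ (1, 0), \row_i (if i == j then (s, 0) else (0, 0))).
have Nd j s : N (d j s) = s ^+ 2.
  rewrite /N (bigD1 j)//= mxE eqxx cnorm2_real big1 ?addr0// => i /negPf ij.
  by rewrite mxE ij cnorm2_real expr0n.
have cd j : continuous (d j).
  apply: pair_continuous; first by move=> s; exact: cvg_cst.
  apply: rV_continuous => i.
  have -> : (fun s => (\row_i (if i == j then (s, 0) else (0, 0))) 0 i) =
      fun s : RR => if i == j then (s, 0) else (0, 0) : CC.
    by apply/funext => s; rewrite mxE.
  case: (i == j); first exact: real_pair_continuous.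
  by move=> s; exact: cvg_cst.
pose P := \big[setU/set0]_(j <- enum 'I_k) (d j @` [set` `[0, r]]).
have PE p : P p <-> exists j s, 0 <= s <= r /\ d j s = p.
  rewrite /P -bigcup_seq; split.
    by move=> [j _ [s /=]]; rewrite in_itv /= => sr <-; exists j, s.
  move=> [j [s [sr <-]]]; exists j; first by rewrite /= mem_enum.
  by exists s => //=; rewrite in_itv.
pose O := [set p : Y | N p < r ^+ 2].
have oO : open O.
  have cN : continuous N.
    apply: (@continuous_sum RR) => j p.
    apply: (@continuous_comp _ _ _ (fun p : Y => p.2 0 j)).
      apply: (@continuous_comp _ _ _ snd (fun w : 'rV[CC]_k => w 0 j)).
        exact: cvg_snd.
      exact: rV_coord_continuous.
    exact: cnorm2_continuous.
  exact: (continuousP _).1 cN _ (@open_lt RR _).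
exists (G @` P), (U `&` F @^-1` O); split; last first.
  by split=> //; rewrite /O /= r2; lra.
apply: (@slice_of_chart _ _ _ a (@vact m k) U (@vert_model m k)) => //.
- apply: bigsetU_compact => j _.
  apply: continuous_compact; first exact: continuous_subspaceT.
  exact: segment_compact.
- move=> _ /PE[j [s [sr <-]]]; split.
  + by move=> i; rewrite /= mxE; case: ifP => // _; rewrite cnorm2_real expr1n.
  + move=> i; rewrite /= mxE; case: ifP => _; rewrite cnorm2_real ?expr0n//.
    nra.
  + move=> i i'; rewrite /= !mxE.
    by case: eqP => [->|//] _; case: eqP => [->|//].
- move=> _ _ t /PE[j [s [sr <-]]] /PE[j' [s' [sr' <-]]] e.
  have ss' : s = s'.
    have : N (vact t (d j s)) = N (d j' s') by rewrite e.
    rewrite Nd (_ : N _ = s ^+ 2).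
      by move=> /eqP; rewrite eqrXn2//; [move/eqP|lra|lra].
    by rewrite -(Nd j); apply: eq_bigr => i _; rewrite mxE cnorm2_rotc.
  rewrite -ss' in e *; congr pair; apply/rowP => i; rewrite !mxE.
  (* All radii share the point [s = 0]; away from it, the disk determines the radius. *)
  have [->|s0] := eqVneq s 0; first by do 2 case: ifP.
  suff -> : j = j' by [].
  move/(congr1 (fun p : Y => cnorm2 (p.2 0 j))): e.
  rewrite /= !mxE eqxx cnorm2_rotc; case: eqP => // _.
  by rewrite !cnorm2_real expr0n => /eqP; rewrite sqrf_eq0 (negPf s0).
- move=> t p; rewrite /O /=; congr (_ < _); apply: eq_bigr => j _.
  by rewrite mxE cnorm2_rotc.
- move=> q Mq Oq; have [j qj Nq] := wedge _ Mq.
  have [th qth] := polar (q.2 0 j).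
  exists (d j (Num.sqrt (cnorm2 (q.2 0 j)))).
  (* Coordinate 0 of the torus rotates the disks, and the others rotate the circles of the first
     factor. *)
  pose t : tvec m :=
    \row_i (if val i == 0%N then th else sval (cid (polar (q.1 0 i)))).
  have t0 : Defs.coord0 t = th.
    rewrite /Defs.coord0 (bigD1 (Ordinal m0))//= big1 ?addr0 ?mxE// => i.
    by move=> /andP[/eqP i0] /eqP[]; exact: val_inj.
  exists t; split.
    apply/PE; exists j, (Num.sqrt (cnorm2 (q.2 0 j))); split=> //.
    rewrite sqrtr_ge0 -(@ler_pXn2r _ 2) ?nnegrE ?sqrtr_ge0//.
    by rewrite sqr_sqrtr ?cnorm2_ge0// -Nq ltW.
  case: (Mq) => Mq1 _ _.
  rewrite [RHS]surjective_pairing; congr pair; apply/rowP => i; rewrite !mxE.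
    have := Mq1 i; case: eqP => [_ ->//|_ q1i].
    by case: cid => u /=; rewrite q1i sqrtr1.
  rewrite t0; case: eqP => [->//|/eqP ij]; rewrite qj//.
  by rewrite /rotc /= !mulr0 subr0 addr0.
- apply: (@sub_finite_set _ _ [set d j r | j in [set: 'I_k]]); last first.
    exact/finite_image/finite_finset.
  move=> _ [/PE[j [s [sr <-]]] nO]; exists j => //; congr d; apply/eqP.
  rewrite eq_le [in X in _ && X](andP sr).2 andbT.
  rewrite leNgt; apply/negP => sr'; apply: nO.
  by rewrite /O /= Nd; nra.
- exact: apsi.
- exact: Fact.
Qed.

(** * Global sections, closed saturations and continuity of automorphisms *)

Lemma lsp_global_section (m : nat) (X : topologicalType) (a : tvec m -> X -> X) :
  lsp_over_graph a ->
  exists K, partial_section a K /\ saturation a K = [set: X].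
Proof.
move=> [m0 [hX [_ [cX [act [_ [_ [_ [free vert]]]]]]]]].
apply: global_section => // x; have [sx|nsx] := pselect (sing_set a x).
  by have [U [k [k0 oU Ux iU]]] := vert x sx; exact: vert_slice.
by have [U [Om [oU Ux iU gOm]]] := free x nsx; exact: free_slice gOm.
Qed.

(** A compact set of representatives of [T^m], standing in for the compactness that [R^m] does not
    have. *)
Definition unit_cube (m : nat) : set (tvec m) :=
  [set t | forall i, `[0, 1]%classic (t ord0 i)].

Lemma unit_cube_compact (m : nat) : compact (@unit_cube m).
Proof.
by apply: (@rV_compact RR m (fun=> `[0, 1]%classic)) => i; exact: segment_compact.
Qed.

Lemma act_unit_cube (m : nat) (X : topologicalType) (a : tvec m -> X -> X) t x :
  torus_action a -> exists2 u, unit_cube u & a u x = a t x.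
Proof.
move=> act.
pose k : 'rV[int]_m := \row_i Num.floor (t 0 i).
have tk : is_intvec (t - (t - intvec k)).
  by exists k; rewrite opprB addrCA subrr addr0.
exists (t - intvec k).
  move=> i; rewrite /= !mxE in_itv /=; have := floor_itv (t 0 i).
  by rewrite intrD => /andP[h1 h2]; apply/andP; split; lra.
have actZ s y : is_intvec s -> a s y = y by case: act => _ _ + _ _; exact.
rewrite (_ : a t x = a (t - (t - intvec k) + (t - intvec k)) x).
  by rewrite [RHS](actD act) (actZ _ _ tk).
by rewrite subrK.
Qed.

(** The saturation is already swept out by the unit cube, hence is compact. *)
Lemma saturation_closed (m : nat) (X : topologicalType) (a : tvec m -> X -> X) K :
  torus_action a -> hausdorff_space X -> compact K -> closed (saturation a K).
Proof.
move=> act hX cK; apply: compact_closed => //.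
have -> : saturation a K = (fun p => a p.1 p.2) @` (@unit_cube m `*` K).
  apply/seteqP; split=> [x [k Kk [t <-]]|_ [[t k] [_ Kk] <-]].
    by have [u cu <-] := act_unit_cube t k act; exists (u, k).
  by exists k => //; exists t.
apply: continuous_compact.
  by apply: continuous_subspaceT; case: act.
by apply: compact_setX => //; exact: unit_cube_compact.
Qed.

Lemma torus_aut_add (m : nat) (psi : tvec m -> tvec m) : torus_aut psi ->
  {morph psi : s t / s + t}.
Proof. by move=> [A [_ ->]] s t; rewrite mulmxDl. Qed.

Lemma torus_aut_sub (m : nat) (psi : tvec m -> tvec m) : torus_aut psi ->
  {morph psi : s t / s - t}.
Proof. by move=> [A [_ ->]] s t; rewrite mulmxBl. Qed.

Lemma mulmx_continuous (R : realType) (m n : nat) (A : 'M[R]_(m, n)) :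
  continuous (fun t : 'rV[R]_m => t *m A).
Proof.
apply: rV_continuous => j.
have -> : (fun t : 'rV[R]_m => (t *m A) 0 j) = fun t => \sum_i t 0 i * A i j.
  by apply/funext => t; rewrite mxE.
apply: continuous_sum => i t.
apply: (@cvgM _ _ (nbhs t)); last exact: cvg_cst.
exact: rV_coord_continuous.
Qed.

Lemma torus_aut_continuous (m : nat) (psi : tvec m -> tvec m) :
  torus_aut psi -> continuous psi.
Proof. by move=> [A [_ ->]]; exact: (@mulmx_continuous RR). Qed.

(** * From sections to equivariant homeomorphisms *)

Section SectionsToHomeomorphism.
Variables (m : nat) (X X' : topologicalType).
Variables (a : tvec m -> X -> X) (a' : tvec m -> X' -> X').
Variables (psi : tvec m -> tvec m).

Lemma eq_homeo_of_sections (K : set X) (K' : set X') :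
  torus_action a -> torus_action a' ->
  hausdorff_space X -> compact [set: X] -> hausdorff_space X' ->
  partial_section a K -> saturation a K = [set: X] ->
  partial_section a' K' -> saturation a' K' = [set: X'] ->
  torus_aut psi -> chardata_iso_via a a' psi -> eq_homeo_via a a' psi.
Proof.
move=> act act' hX cX hX' [cK uK] KT [cK' uK'] K'T apsi.
move=> [g [h [go [ho [hg [gh [gc [_ [_ gstab]]]]]]]]].
have sym := same_orbit_sym act; have sym' := same_orbit_sym act'.
have [phi _ [psiK phiK]] := torus_aut_inverse apsi.
have psiD := torus_aut_add apsi; have psiB := torus_aut_sub apsi.
have cpsi := torus_aut_continuous apsi.
have repr' (y : X') : exists k, K' k /\ same_orbit a' k y.
  have : saturation a' K' y by rewrite K'T.
  by move=> [k ? ?]; exists k.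
pose Phi x := sval (cid (repr' (g x))).
have PhiK' x : K' (Phi x) by rewrite /Phi; case: cid => k [].
have Phig x : same_orbit a' (Phi x) (g x) by rewrite /Phi; case: cid => k [].
(* The preimage of a closed [C] under [Phi] is the preimage under [g] of the saturation of [K']&[C],
   a closed invariant set. Since [g] is only controlled on invariant open sets, complements are
   taken. *)
have cPhi : continuous Phi.
  apply/continuous_closedP => C cC.
  have clS : closed (saturation a' (K' `&` C)).
    by apply: saturation_closed => //; exact: compact_closedI.
  have -> : Phi @^-1` C = ~` (g @^-1` (~` saturation a' (K' `&` C))).
    apply/seteqP; split=> x /=.
      by move=> Cx; apply; exists (Phi x).
    move=> /contrapT[k [K'k Ck] kg]; rewrite (_ : Phi x = k)//.
    by apply: uK' => //; apply: (same_orbit_trans act') (Phig x) _; exact: sym'.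
  apply: open_closedC; apply: gc; first exact: closed_openC.
  move=> t y nS Sy; apply/nS/(saturation_same_orbit act' _ Sy).
  by apply: sym'; exists t.
have reprX x : exists kt : X * tvec m, K kt.1 /\ a kt.2 kt.1 = x.
  have : saturation a K x by rewrite KT.
  by move=> [k Kk [t tx]]; exists (k, t).
pose F x := let kt := sval (cid (reprX x)) in a' (psi kt.2) (Phi kt.1).
have stabE k : stab a' (Phi k) = psi @` stab a k.
  by rewrite gstab; exact: stab_same_orbit.
(* Both sides say that [s - t] is in the isotropy group, up to [psi]. One direction makes [F]
   independent of the chosen pair, the other makes it injective on each orbit. *)
have eqP' k s t : a s k = a t k <-> a' (psi s) (Phi k) = a' (psi t) (Phi k).
  have diff (Y : topologicalType) (b : tvec m -> Y -> Y) u v y :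
      torus_action b -> b u y = b v y <-> stab b y (u - v).
    move=> actb; rewrite /stab /=; split=> [uv|uv].
      by rewrite addrC (actD actb) uv (actNK actb).
    by rewrite -[in LHS](subrK v u) addrC (actD actb) uv.
  rewrite (diff _ a)// (diff _ a')// stabE -psiB; split; first by exists (s - t).
  by move=> [u ku /(can_inj psiK) <-].
have FE t k : K k -> F (a t k) = a' (psi t) (Phi k).
  rewrite /F; case: cid => -[k' t'] [/= Kk' e] Kk.
  have kk' : k' = k.
    by apply: uK => //; exists (- t + t'); rewrite (actD act) e (actNK act).
  by rewrite kk' in e *; apply/eqP'.
have Feq t x : F (a t x) = a' (psi t) (F x).
  have [[k s] [/= Kk <-]] := reprX x.
  by rewrite -(actD act) !FE// psiD (actD act').
have Fsurj y : exists x, F x = y.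
  have [k' [K'k' [t <-]]] := repr' y.
  have [[k s] [/= Kk sk]] := reprX (h k').
  have kk' : Phi k = k'.
    apply: uK' => //; apply: (same_orbit_trans act') (Phig k) _.
    apply: (same_orbit_trans act') (gh k').
    by apply: go; exists s.
  by exists (a (phi t) k); rewrite FE// phiK kk'.
have Finj : injective F.
  move=> x y; have [[k s] [/= Kk <-]] := reprX x.
  have [[l t] [/= Kl <-]] := reprX y; rewrite !FE// => e.
  have kl : k = l.
    apply: uK => //.
    have gkl : same_orbit a' (g k) (g l).
      apply: (same_orbit_trans act') (sym' _ _ (Phig k)) _.
      apply: (same_orbit_trans act') (Phig l).
      by exists (- psi t + psi s); rewrite (actD act') e (actNK act').
    apply: (same_orbit_trans act) (sym _ _ (hg k)) _.
    by apply: (same_orbit_trans act) (hg l); exact: ho.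
  by rewrite kl in e *; apply/eqP'.
(* The preimage of a closed set is the image under the action map of a closed part [E] of the cube
   times [K], hence compact. *)
have cF : continuous F.
  apply/continuous_closedP => C cC; apply: compact_closed => //.
  pose E := (@unit_cube m `*` K) `&` (fun p => a' (psi p.1) (Phi p.2)) @^-1` C.
  have -> : F @^-1` C = (fun p => a p.1 p.2) @` E.
    apply/seteqP; split=> [x /= Cx|_ [[t k] [[_ Kk] /= Ck] <-]].
      have [[k s] [/= Kk sx]] := reprX x.
      have [u cu us] := act_unit_cube s k act.
      exists (u, k); last by rewrite /= us.
      by split=> //=; rewrite -FE// us sx.
    by rewrite /= FE.
  apply: continuous_compact.
    by apply: continuous_subspaceT; case: act.
  apply: compact_closedI.
    by apply: compact_setX => //; exact: unit_cube_compact.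
  apply: preimage_closed => // p _; apply: act_continuous => // {}p.
    by apply: continuous_comp; [exact: cvg_fst|exact: cpsi].
  by apply: continuous_comp; [exact: cvg_snd|exact: cPhi].
pose G y := sval (cid (Fsurj y)).
have FG : cancel G F by move=> y; rewrite /G; case: cid.
have GF : cancel F G by move=> x; apply: Finj; rewrite FG.
exists F, G; split=> //.
(* A continuous bijection from a compact space to a Hausdorff one is closed. *)
apply/continuous_closedP => C cC.
have -> : G @^-1` C = F @` C.
  apply/seteqP; split=> [y Cy|_ [x Cx <-]]; first by exists (G y).
  by rewrite /= GF.
apply: compact_closed => //; apply: continuous_compact.
  exact: continuous_subspaceT.
exact: (subclosed_compact _ cX).
Qed.

(** If the rows of [B] span the first isotropy torus, those of [B *m A] span its image. This is what
    carries singular sets to singular sets in the converse. *)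
Lemma isotropy_dim_torus_aut x y d : torus_aut psi ->
  psi @` stab a x = stab a' y -> isotropy_dim a x d -> isotropy_dim a' y d.
Proof.
move=> apsi stabxy [B [iB sB]].
have [phi _ [psiK _]] := torus_aut_inverse apsi.
move: (can_inj psiK) stabxy; case: apsi => A [detA ->] injA stabxy {psiK}.
pose f := (intmul 1 : {rmorphism int -> RR}).
have uA := unimodular_unitmx detA.
exists (B *m A); split.
  move=> c; rewrite -/f (map_mxM f) mulmxA => cBA; apply: iB.
  by apply: injA; rewrite /= -/f cBA mul0mx.
have intA (k : 'rV[int]_m) : intvec k *m map_mx f A = intvec (k *m A).
  by rewrite /intvec -(map_mxM f).
rewrite -stabxy sB; apply/seteqP; split=> [_ [t [c [k ->]] <-]|t [c [k ->]]].
  exists c, (k *m A).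
  by rewrite -/f mulmxDl (map_mxM f) mulmxA intA.
(* The integral part is pulled back by [invmx A], which is again an integer matrix. *)
exists (c *m map_mx f B + intvec (k *m invmx A)).
  by exists c, (k *m invmx A).
by rewrite -/f mulmxDl intA -(mulmxA k) mulVmx// mulmx1 (map_mxM f) mulmxA.
Qed.

End SectionsToHomeomorphism.

(** * From homeomorphisms back to characteristic data, and the equivalence *)

Lemma chardata_iso_of_homeo (m : nat) (X X' : topologicalType)
    (a : tvec m -> X -> X) (a' : tvec m -> X' -> X') (psi : tvec m -> tvec m) :
  torus_action a -> torus_action a' ->
  torus_aut psi -> eq_homeo_via a a' psi -> chardata_iso_via a a' psi.
Proof.
move=> act act' apsi [F [G [cF cG FK GK Feq]]].
have [phi aphi [psiK phiK]] := torus_aut_inverse apsi.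
have Geq t y : G (a' t y) = a (phi t) (G y).
  by apply: (can_inj FK); rewrite GK Feq phiK GK.
have stabF x : psi @` stab a x = stab a' (F x).
  apply/seteqP; split=> [_ [t tx <-]|t]; rewrite /stab /=.
    by rewrite -Feq tx.
  move=> tx; exists (phi t); last exact: phiK.
  by apply: (can_inj FK); rewrite Feq phiK.
have stabG x : phi @` stab a' (F x) = stab a x.
  rewrite -stabF; apply/seteqP; split=> [_ [_ [t tx <-] <-]|t tx].
    by rewrite psiK.
  by exists (psi t); [exists t|rewrite psiK].
exists F, G; split; first by move=> x y [t <-]; exists (psi t); rewrite -Feq.
split; first by move=> x y [t <-]; exists (phi t); rewrite -Geq.
split; first by move=> x; rewrite FK; exact: same_orbit_refl.
split; first by move=> x; rewrite GK; exact: same_orbit_refl.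
split; first by move=> W oW _; exact: (continuousP _).1 cF _ oW.
split; first by move=> W oW _; exact: (continuousP _).1 cG _ oW.
split=> // x; split=> -[d [dx dm]]; exists d; split=> //.
  exact: isotropy_dim_torus_aut (stabF x) dx.
exact: isotropy_dim_torus_aut (stabG x) dx.
Qed.

Theorem mainTheorem6 (m : nat) (X X' : topologicalType)
  (a : tvec m -> X -> X) (a' : tvec m -> X' -> X') :
  lsp_over_graph a -> lsp_over_graph a' ->
  (chardata_iso_via a a' id <-> eq_homeo_via a a' id) /\
  ((exists psi, torus_aut psi /\ chardata_iso_via a a' psi) <->
   (exists psi, torus_aut psi /\ eq_homeo_via a a' psi)).
Proof.
move=> lspX lspX'.
have equiv psi : torus_aut psi ->
    chardata_iso_via a a' psi <-> eq_homeo_via a a' psi.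
  move=> apsi.
  have [K [sK KT]] := lsp_global_section lspX.
  have [K' [sK' K'T]] := lsp_global_section lspX'.
  case: lspX => [_ [hX [_ [cX [act _]]]]].
  case: lspX' => [_ [hX' [_ [_ [act' _]]]]].
  split; last exact: chardata_iso_of_homeo.
  exact: (eq_homeo_of_sections act act' hX cX hX' sK KT sK' K'T).
split; last by split=> -[psi [apsi /(equiv _ apsi)]]; exists psi.
apply: equiv; exists 1%:M; split; first by left; rewrite det1.
apply/funext => t.
by rewrite (map_mx1 (intmul 1 : {rmorphism int -> RR})) mulmx1.
Qed.
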